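(* Assume $\mu>0$. The cost function $J:\mathbb{K}\to\mathbb{R}$ is coercive in the following sense: for any sequence $\{K_i\}_{i=1}^{\infty}\subseteq \mathbb{K}$, if $\|K_i\|\to+\infty$, or if $K_i\to K$ for some $K\in\partial\mathbb{K}$, then $J(K_i)\to+\infty$.
   Context: Setting: $A\in\mathbb{R}^{n\times n}$, $B\in\mathbb{R}^{n\times m}$, $C\in\mathbb{R}^{d\times n}$ with $C$ of full row rank; $Q\in\mathbb{R}^{n\times n}$ and $R\in\mathbb{R}^{m\times m}$ are symmetric positive definite. The system is $x_{t+1}=Ax_t+Bu_t$, $y_t=Cx_t$, with static output feedback $u_t=-Ky_t$, $K\in\mathbb{R}^{m\times d}$, so that $x_{t+1}=(A-BKC)x_t$. The initial state $x_0$ is drawn from a distribution $\mathcal{D}$ with second-moment matrix $X_0:=\mathbb{E}_{x_0\sim\mathcal{D}}[x_0x_0^\top]\in\mathbb{R}^{n\times n}$, and $\mu:=\sigma_{\min}(X_0)$ is the minimal singular value of $X_0$. The feasible set is $\mathbb{K}=\{K\in\mathbb{R}^{m\times d}:\rho(A-BKC)<1\}$ ($\rho$ = spectral radius), assumed nonempty; $\partial\mathbb{K}$ is its boundary in $\mathbb{R}^{m\times d}$. For $K\in\mathbb{K}$ the cost is $J(K)=\mathbb{E}_{x_0\sim\mathcal{D}}\big[\sum_{t=0}^\infty x_t^\top(Q+C^\top K^\top RKC)x_t\big]$. Equivalently $J(K)=\mathrm{Tr}(P_KX_0)$, where $P_K$ is the solution of $P_K=Q+C^\top K^\top RKC+(A-BKC)^\top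 P_K(A-BKC)$. $\|\cdot\|$ is the spectral norm. *)

(* Defs.v *)
From HB Require Import structures.
From mathcomp Require Import all_boot all_order all_algebra.
From mathcomp Require Import complex.
From mathcomp Require Import all_classical all_reals all_analysis.

Set Implicit Arguments.
Unset Strict Implicit.
Unset Printing Implicit Defensive.

Import Order.TTheory GRing.Theory Num.Theory.
Import numFieldNormedType.Exports.

Local Open Scope classical_set_scope.
Local Open Scope ring_scope.

Definition euclidean_norm (R : realType) (n : nat) (x : 'cV[R]_n) : R :=
  Num.sqrt (\sum_(i < n) x i 0 ^+ 2).

(* The operator norm induced by the Euclidean norms; the library norm
   on matrices is the entrywise maximum. *)
Definition spectral_norm (R : realType) (m n : nat) (M : 'M[R]_(m, n)) : R :=
  sup [set euclidean_norm (M *m x) | x in [set x | euclidean_norm x <= 1]].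

(* The eigenvalues are taken in the complex numbers over R. For n > 0 they
   form a finite nonempty set, so that the supremum is a maximum. *)
Definition spectral_radius (R : realType) (n : nat) (M : 'M[R]_n) : R :=
  sup [set ComplexField.Normc.normc l | l in
        [set l : complex R | eigenvalue (map_mx (real_complex R) M) l]].

(* The eigenvalues of the symmetric matrix M^T M are all real and
   nonnegative; for n > 0 they form a finite nonempty set, so that the infimum
   is a minimum. For n = 0 the value is 0. *)
Definition min_singular_value (R : realType) (n : nat) (M : 'M[R]_n) : R :=
  inf [set Num.sqrt a | a in [set a | eigenvalue (M^T *m M) a]].

Definition sym_posdef (R : realType) (n : nat) (M : 'M[R]_n) : Prop :=
  M^T = M /\ forall x : 'cV[R]_n, x != 0 -> 0 < (x^T *m M *m x) 0 0.

(* R^n with its Borel sigma-algebra. *)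
Notation borel_cV R n := (g_sigma_algebraType (@open 'cV[R]_n)).

Definition boundary (T : topologicalType) (A : set T) : set T :=
  closure A `&` closure (~` A).

Definition second_moments (R : realType) (n : nat)
    (D : probability (borel_cV R n) R) : Prop :=
  forall i j : 'I_n,
    D.-integrable setT
      (fun x : borel_cV R n => ((x : 'cV[R]_n) i 0 * (x : 'cV[R]_n) j 0)%R%:E).

Definition second_moment_mx (R : realType) (n : nat)
    (D : probability (borel_cV R n) R) : 'M[R]_n :=
  \matrix_(i < n, j < n)
    fine 'E_D[fun x : borel_cV R n => (x : 'cV[R]_n) i 0 * (x : 'cV[R]_n) j 0].

Definition closed_loop (R : realType) (n m d : nat)
    (A : 'M[R]_n) (B : 'M[R]_(n, m)) (C : 'M[R]_(d, n)) (K : 'M[R]_(m, d)) :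
    'M[R]_n :=
  A - B *m K *m C.

Definition feasible (R : realType) (n m d : nat)
    (A : 'M[R]_n) (B : 'M[R]_(n, m)) (C : 'M[R]_(d, n)) : set 'M[R]_(m, d) :=
  [set K | spectral_radius (closed_loop A B C K) < 1].

Fixpoint state (R : realType) (n m d : nat)
    (A : 'M[R]_n) (B : 'M[R]_(n, m)) (C : 'M[R]_(d, n)) (K : 'M[R]_(m, d))
    (x0 : 'cV[R]_n) (t : nat) : 'cV[R]_n :=
  if t is t'.+1 then
    let x := state A B C K x0 t' in
    let y := C *m x in
    let u := - (K *m y) in
    A *m x + B *m u
  else x0.

Definition stage_cost (R : realType) (n m d : nat)
    (Q : 'M[R]_n) (Ru : 'M[R]_m) (C : 'M[R]_(d, n)) (K : 'M[R]_(m, d))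
    (x : 'cV[R]_n) : R :=
  (x^T *m (Q + C^T *m K^T *m Ru *m K *m C) *m x) 0 0.

(* The sum and the integral are those of nonnegative extended reals. The result
   is finite when K is feasible and D has finite second moments; otherwise
   fine sends an infinite value to 0. *)
Definition cost (R : realType) (n m d : nat)
    (A : 'M[R]_n) (B : 'M[R]_(n, m)) (C : 'M[R]_(d, n))
    (Q : 'M[R]_n) (Ru : 'M[R]_m) (D : probability (borel_cV R n) R)
    (K : 'M[R]_(m, d)) : R :=
  fine (\int[D]_x \sum_(0 <= t <oo) (stage_cost Q Ru C K (state A B C K x t))%:E)%E.

(* Main.v *)
Require Import Defs.
From HB Require Import structures.
From mathcomp Require Import all_boot all_order all_algebra.
From mathcomp Require Import complex.
From mathcomp Require Import all_classical all_reals all_analysis.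
From mathcomp Require Import ring lra.

Set Implicit Arguments.
Unset Strict Implicit.
Unset Printing Implicit Defensive.

Import Order.TTheory GRing.Theory Num.Theory.
Import numFieldNormedType.Exports.

Local Open Scope classical_set_scope.
Local Open Scope ring_scope.

(** Write M K = A - B K C for the closed loop and sqF for the square of the
    Frobenius norm. By linearity of the expectation, E[x^T S x] = tr (S X0), so
    that the cost is the sum over t of the step costs
    tr ((M K ^+ t)^T W M K ^+ t X0), where W is the positive definite matrix
    Q + C^T K^T Ru K C. The second moment matrix X0 is positive semidefinite,
    and its positive minimal singular value makes it invertible, hence
    coercive: v^T X0 v >= c |v|^2 ([psd_unit_lower]). With the same bound for Q
    and Ru, this gives two lower bounds, uniform in K, for the step costs:
    - the step cost at time t is at least c * sqF (M K ^+ t)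
      ([step_cost_ge]);
    - the step cost at time 0 is at least c * sqF K, because C has a right
      inverse ([step_cost0_ge]).

    The second bound settles the case of an unbounded sequence of gains. For
    the other case, the key is the criterion [spectral_radius_lt1P]: the
    spectral radius of M is less than 1 exactly when sqF (M ^+ t) < 1 for some
    t > 0. The condition on the right is open in M, so the feasible set is open
    and a boundary point K is infeasible. By the criterion again,
    sqF (M K ^+ t) >= 1 for every t > 0, so the first bound makes the partial
    sums of the step costs of K unbounded. A partial sum of step costs is a
    polynomial in the entries of the gain, hence continuous: when K_ i tends to
    K, a partial sum exceeding a at K eventually exceeds a at K_ i, and so
    does the full cost.

    Both cases bound the cost from below by a partial sum. Since an
    infinite value of the series would give the cost 0, this needs the series
    to be finite for a feasible gain ([partial_cost_le]), which follows from
    the summability of sqF (M ^+ t) when the spectral radius is less than 1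
    ([pow_sum_bounded]).

    That powers of such an M tend to 0 is proved without a normal form. If the
    characteristic polynomial is the product of the 'X - z, Cayley-Hamilton
    says that the sequence of the powers is annihilated by the product of the
    operators (shift - z), and each operator can be removed in turn, since
    u (t + 1) - z u t -> 0 with |z| < 1 forces u -> 0
    ([contraction_cvg0], [horner_pow_cvg0]). *)

(** * Quadratic forms and the Frobenius norm *)

(** The case c = 0, where b has to vanish, is what gives Cauchy-Schwarz for
    degenerate forms. *)
Lemma discriminant_le (R : realFieldType) (a b c : R) : 0 <= c ->
  (forall t, 0 <= a + t * b *+ 2 + t ^+ 2 * c) -> b ^+ 2 <= a * c.
Proof.
rewrite le_eqVlt => /predU1P[<-|c0] h.
  have [->|b0] := eqVneq b 0; first by rewrite expr0n mulr0.
  have := h (- (a + 1) / b).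
  by rewrite divfK // mulr0 addr0; have := h 0; lra.
have := h (- b / c); rewrite expr_div_n.
have -> : a + - b / c * b *+ 2 + (- b) ^+ 2 / c ^+ 2 * c = (a * c - b ^+ 2) / c.
  by field; rewrite gt_eqF.
by rewrite pmulr_lge0 ?invr_gt0 // subr_ge0.
Qed.

(** Cauchy-Schwarz: the sum of the (a i + t * b i) ^+ 2 is a nonnegative
    quadratic polynomial in t. *)
Lemma sum_mul_sq_le (R : realFieldType) (n : nat) (a b : 'I_n -> R) :
  (\sum_i a i * b i) ^+ 2 <= (\sum_i a i ^+ 2) * (\sum_i b i ^+ 2).
Proof.
apply: discriminant_le => [|t]; first by apply: sumr_ge0 => i _; exact: sqr_ge0.
have -> : \sum_i a i ^+ 2 + t * (\sum_i a i * b i) *+ 2 +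
    t ^+ 2 * (\sum_i b i ^+ 2) = \sum_i (a i + t * b i) ^+ 2.
  rewrite !mulr_sumr -sumrMnl -!big_split /=; apply: eq_bigr => i _; ring.
by apply: sumr_ge0 => i _; exact: sqr_ge0.
Qed.

(** The square of the Frobenius norm; on a column vector, of the Euclidean
    norm. The square avoids square roots and is a polynomial in the entries. *)
Definition sqF (R : realFieldType) (m n : nat) (M : 'M[R]_(m, n)) : R :=
  \sum_i \sum_j M i j ^+ 2.

Lemma sqF_ge0 (R : realFieldType) (m n : nat) (M : 'M[R]_(m, n)) : 0 <= sqF M.
Proof. by do 2![apply: sumr_ge0 => ? _]; exact: sqr_ge0. Qed.

Lemma sqF_trace (R : realFieldType) (m n : nat) (M : 'M[R]_(m, n)) :
  sqF M = \tr (M *m M^T).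
Proof.
by apply: eq_bigr => i _; rewrite mxE; apply: eq_bigr => j _; rewrite mxE expr2.
Qed.

Lemma sqF_tr (R : realFieldType) (m n : nat) (M : 'M[R]_(m, n)) :
  sqF M^T = sqF M.
Proof. by rewrite !sqF_trace trmxK mxtrace_mulC. Qed.

Lemma sqF_col (R : realFieldType) (n : nat) (x : 'cV[R]_n) :
  sqF x = (x^T *m x) 0 0.
Proof. by rewrite sqF_trace mxtrace_mulC trace_mx11. Qed.

Lemma sqF_rows (R : realFieldType) (m n : nat) (M : 'M[R]_(m, n)) :
  sqF M = \sum_i sqF (row i M)^T.
Proof.
apply: eq_bigr => i _; rewrite sqF_tr /sqF big_ord1.
by apply: eq_bigr => j _; rewrite mxE.
Qed.

Lemma sqF_mulmx (R : realFieldType) (m n p : nat)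
  (M : 'M[R]_(m, n)) (N : 'M[R]_(n, p)) : sqF (M *m N) <= sqF M * sqF N.
Proof.
rewrite -(sqF_tr N) {1 2}/sqF mulr_suml; apply: ler_sum => i _.
rewrite /sqF mulr_sumr; apply: ler_sum => j _; rewrite mxE.
under [X in _ <= _ * X]eq_bigr => k _ do rewrite mxE.
exact: sum_mul_sq_le.
Qed.

Lemma spectral_norm_le (R : realType) (m n : nat) (M : 'M[R]_(m, n)) :
  spectral_norm M <= Num.sqrt (sqF M).
Proof.
have normE k (x : 'cV[R]_k) : euclidean_norm x = Num.sqrt (sqF x).
  by congr Num.sqrt; apply: eq_bigr => i _; rewrite big_ord1.
apply: ge_sup => [|_ [x /= x1 <-]].
  exists (euclidean_norm (M *m 0)), 0 => //=.
  rewrite /euclidean_norm big1 ?sqrtr0 ?ler01 // => i _.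
  by rewrite mxE expr0n.
rewrite normE ler_wsqrtr // (le_trans (sqF_mulmx _ _)) //.
rewrite ler_piMr ?sqF_ge0 //.
by move: x1; rewrite normE -[leRHS]sqrtr1 ler_psqrt ?nnegrE ?sqF_ge0.
Qed.

Definition quad (R : realFieldType) (n : nat) (X : 'M[R]_n)
    (x : 'cV[R]_n) : R :=
  (x^T *m X *m x) 0 0.

Lemma quadE (R : realFieldType) (n : nat) (S : 'M[R]_n) x :
  quad S x = \sum_i \sum_j S i j * (x i 0 * x j 0).
Proof.
rewrite /quad -mulmxA mxE; apply: eq_bigr => i _; rewrite !mxE mulr_sumr.
by apply: eq_bigr => j _; rewrite mulrCA.
Qed.

Lemma quadD (R : realFieldType) (n : nat) (X Y : 'M[R]_n) x :
  quad (X + Y) x = quad X x + quad Y x.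
Proof. by rewrite /quad mulmxDr mulmxDl mxE. Qed.

Lemma quadZ (R : realFieldType) (n : nat) (c : R) (X : 'M[R]_n) x :
  quad (c *: X) x = c * quad X x.
Proof. by rewrite /quad -scalemxAr -scalemxAl mxE. Qed.

Lemma quad_congr (R : realFieldType) (m n : nat) (X : 'M[R]_m)
    (G : 'M[R]_(m, n)) x :
  quad (G^T *m X *m G) x = quad X (G *m x).
Proof. by rewrite /quad trmx_mul !mulmxA. Qed.

Lemma quad_gram (R : realFieldType) (m n : nat) (G : 'M[R]_(m, n)) x :
  quad (G^T *m G) x = sqF (G *m x).
Proof. by rewrite sqF_col trmx_mul /quad !mulmxA. Qed.

Lemma quad_outer_ge0 (R : realFieldType) (n : nat) (v x : 'cV[R]_n) :
  0 <= quad (v *m v^T) x.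
Proof.
rewrite /quad mulmxA -mulmxA mxE big_ord1.
have -> : v^T *m x = (x^T *m v)^T by rewrite trmx_mul trmxK.
by rewrite [_^T _ _]mxE -expr2 sqr_ge0.
Qed.

(** From 2 <x, Y x> <= |x|^2 + |Y x|^2. *)
Lemma quad_le (R : realFieldType) (n : nat) (Y : 'M[R]_n) x :
  quad Y x <= (1 + sqF Y) * sqF x.
Proof.
suff h : quad Y x *+ 2 <= (1 + sqF Y) * sqF x.
  have := mulr_ge0 (addr_ge0 ler01 (sqF_ge0 Y)) (sqF_ge0 x); lra.
apply: (@le_trans _ _ (sqF x + sqF (Y *m x))); last first.
  by rewrite mulrDl mul1r lerD2l sqF_mulmx.
rewrite /quad -mulmxA mxE /sqF -sumrMnl -big_split; apply: ler_sum => i _ /=.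
rewrite !big_ord1 mxE.
by have := sqr_ge0 (x i 0 - (Y *m x) i 0); rewrite sqrrB; lra.
Qed.

Lemma psd_cauchy_schwarz (R : realFieldType) (n : nat) (X : 'M[R]_n)
    (Xsym : X^T = X) (Xpsd : forall x, 0 <= quad X x) (u v : 'cV[R]_n) :
  (u^T *m X *m v) 0 0 ^+ 2 <= quad X u * quad X v.
Proof.
apply: discriminant_le => // t.
have vu : v^T *m X *m u = (u^T *m X *m v)^T.
  by rewrite !trmx_mul trmxK Xsym mulmxA.
have := Xpsd (u + t *: v); rewrite /quad.
have -> : (u + t *: v)^T = u^T + t *: v^T by apply/matrixP => i j; rewrite !mxE.
rewrite !(mulmxDl, mulmxDr) -!(scalemxAl, scalemxAr) vu.
set p := u^T *m X *m u; set q := u^T *m X *m v; set r := v^T *m X *m v.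
by rewrite !mxE; congr (_ <= _); ring.
Qed.

(** Coercivity without compactness or diagonalization. For y = X^-1 x,
    Cauchy-Schwarz for the form X reads |x|^4 <= (x^T X x) (y^T X y), and
    y^T X y = y^T x is at most a constant times |x|^2. *)
Lemma psd_unit_lower (R : realFieldType) (n : nat) (X : 'M[R]_n)
    (Xsym : X^T = X) (Xpsd : forall x, 0 <= quad X x) (Xunit : X \in unitmx) :
  exists2 c : R, 0 < c & forall x, c * sqF x <= quad X x.
Proof.
have L0 : 0 < 1 + sqF (invmx X)^T by rewrite ltr_pwDl ?sqF_ge0.
exists (1 + sqF (invmx X)^T)^-1 => [|x]; first by rewrite invr_gt0.
rewrite mulrC ler_pdivrMr //.
have := psd_cauchy_schwarz Xsym Xpsd x (invmx X *m x).
rewrite -mulmxA mulKVmx // -sqF_col.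
have -> : quad X (invmx X *m x) = quad (invmx X)^T x.
  by rewrite -quad_congr -mulmxA mulmxV // mulmx1.
have := quad_le (invmx X)^T x; have := Xpsd x; have := sqF_ge0 x.
rewrite le_eqVlt => /predU1P[<- q0 _ _|s0 q0 h1 h2].
  by rewrite mulr_ge0 // ltW.
rewrite -(ler_pM2r s0) -expr2 (le_trans h2) // -mulrA.
exact: ler_wpM2l.
Qed.

Lemma posdef_unit (R : realType) (n : nat) (X : 'M[R]_n) :
  sym_posdef X -> X \in unitmx.
Proof.
case=> Xsym Xpos; rewrite -row_free_unit -kermx_eq0; apply: contraT => /rowV0Pn.
case=> v /sub_kermxP vX v0; have := Xpos v^T; rewrite trmx_eq0 trmxK.
by move=> /(_ v0); rewrite vX mul0mx mxE ltxx.
Qed.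

Lemma posdef_psd (R : realType) (n : nat) (X : 'M[R]_n) x :
  sym_posdef X -> 0 <= quad X x.
Proof.
case=> _ Xpos; have [->|/Xpos/ltW//] := eqVneq x 0.
by rewrite /quad mulmx0 mxE.
Qed.

Lemma posdef_lower (R : realType) (n : nat) (X : 'M[R]_n) : sym_posdef X ->
  exists2 c : R, 0 < c & forall x, c * sqF x <= quad X x.
Proof.
move=> X_pd; apply: psd_unit_lower; first by case: X_pd.
  by move=> x; exact: posdef_psd.
exact: posdef_unit.
Qed.

(** * Entrywise convergence of matrices *)

Lemma cvgr_sum (R : realType) (I T : Type) (F : set_system T) {FF : Filter F}
    (r : seq I) (f : I -> T -> R) (l : I -> R) :
  (forall i, f i x @[x --> F] --> l i) ->
  \sum_(i <- r) f i x @[x --> F] --> \sum_(i <- r) l i.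
Proof. by move=> fl; apply: cvg_big => //; exact: add_continuous. Qed.

Lemma cvg_sqF (R : realType) (T : Type) (F : set_system T) {FF : Filter F}
    (m n : nat) (M : T -> 'M[R]_(m, n)) (L : 'M[R]_(m, n)) :
  (forall i j, M x i j @[x --> F] --> L i j) ->
  sqF (M x) @[x --> F] --> sqF L.
Proof.
move=> ML; apply: cvgr_sum => i; apply: cvgr_sum => j.
by rewrite expr2; under eq_fun do rewrite expr2; apply: cvgM.
Qed.

Section entrywise_convergence.
Variables (R : realType) (T : Type) (F : set_system T).
Context {FF : Filter F}.

(** Stated on entries because a product of matrices then converges as a finite
    sum of products of converging scalars. *)
Definition entry_cvg (m n : nat) (M : T -> 'M[R]_(m, n)) (L : 'M[R]_(m, n)) :=
  forall i j, M x i j @[x --> F] --> L i j.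

Lemma entry_cvg_cst (m n : nat) (L : 'M[R]_(m, n)) : entry_cvg (fun=> L) L.
Proof. by move=> i j; exact: cvg_cst. Qed.

Lemma entry_cvg_mul (m n p : nat) (M : T -> 'M[R]_(m, n)) L
    (N : T -> 'M[R]_(n, p)) L' :
  entry_cvg M L -> entry_cvg N L' -> entry_cvg (fun x => M x *m N x) (L *m L').
Proof.
move=> ML NL i j; rewrite mxE; under eq_fun do rewrite mxE.
by apply: cvgr_sum => k; apply: cvgM; [exact: ML|exact: NL].
Qed.

Lemma entry_cvg_add (m n : nat) (M N : T -> 'M[R]_(m, n)) L L' :
  entry_cvg M L -> entry_cvg N L' -> entry_cvg (fun x => M x + N x) (L + L').
Proof.
move=> ML NL i j; rewrite mxE; under eq_fun do rewrite mxE.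
by apply: cvgD; [exact: ML|exact: NL].
Qed.

Lemma entry_cvg_opp (m n : nat) (M : T -> 'M[R]_(m, n)) L :
  entry_cvg M L -> entry_cvg (fun x => - M x) (- L).
Proof.
move=> ML i j; rewrite mxE; under eq_fun do rewrite mxE.
by apply: cvgN; exact: ML.
Qed.

Lemma entry_cvg_tr (m n : nat) (M : T -> 'M[R]_(m, n)) L :
  entry_cvg M L -> entry_cvg (fun x => (M x)^T) L^T.
Proof.
by move=> ML i j; rewrite mxE; under eq_fun do rewrite mxE; exact: ML.
Qed.

Lemma entry_cvg_exp (n : nat) (M : T -> 'M[R]_n) L t :
  entry_cvg M L -> entry_cvg (fun x => M x ^+ t) (L ^+ t).
Proof.
move=> ML; elim: t => [|t IH]; first exact: entry_cvg_cst.
rewrite exprS; under eq_fun do rewrite exprS; exact: entry_cvg_mul.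
Qed.

Lemma entry_cvg_trace (n : nat) (M : T -> 'M[R]_n) L :
  entry_cvg M L -> \tr (M x) @[x --> F] --> \tr L.
Proof. by move=> ML; apply: cvgr_sum => i; exact: ML. Qed.

Lemma cvg_entry_cvg (m n : nat) (M : T -> 'M[R]_(m, n)) L :
  M x @[x --> F] --> L -> entry_cvg M L.
Proof.
move=> ML i j; exact: (cvg_comp M (fun A : 'M[R]_(m, n) => A i j) ML
  (@coord_continuous _ _ _ i j L)).
Qed.

Lemma entry_cvg_closed_loop (n m d : nat) (A : 'M[R]_n) (B : 'M[R]_(n, m))
    (C : 'M[R]_(d, n)) (K_ : T -> 'M[R]_(m, d)) K :
  entry_cvg K_ K ->
  entry_cvg (fun x => closed_loop A B C (K_ x)) (closed_loop A B C K).
Proof.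
move=> KK; apply: entry_cvg_add; first exact: entry_cvg_cst.
apply: entry_cvg_opp; apply: entry_cvg_mul; last exact: entry_cvg_cst.
by apply: entry_cvg_mul; first exact: entry_cvg_cst.
Qed.

End entrywise_convergence.

(** * Powers of a matrix and its spectral radius *)

(** If b <= e / 2 * (1 - r) from T on, then e / 2 is a fixed point of the
    majorizing recursion, so a (k + T) <= r ^+ k * a T + e / 2. *)
Lemma contraction_cvg0 (R : realType) (r : R) (a b : nat -> R) :
  0 <= r < 1 -> (forall t, 0 <= a t) -> (forall t, a t.+1 <= r * a t + b t) ->
  b t @[t --> \oo] --> 0 -> a t @[t --> \oo] --> 0.
Proof.
move=> /andP[r0 r1] a0 ab b_cvg; apply/cvgr0Pnorm_lt => e e0.
have d0 : 0 < e / 2 * (1 - r) by rewrite mulr_gt0 ?subr_gt0 // divr_gt0.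
have [T _ bT] := cvgr0_norm_lt b b_cvg _ d0.
have aT k : a (k + T)%N <= r ^+ k * a T + e / 2.
  elim: k => [|k IH]; first by rewrite expr0 mul1r lerDl ltW // divr_gt0.
  have := bT (k + T)%N (leq_addl _ _) => /= /(le_lt_trans (ler_norm _)) bk.
  rewrite addSn (le_trans (ab _)) // exprS -mulrA.
  have := ler_wpM2l r0 IH; lra.
have : geometric (a T) r @ \oo --> 0 by apply: cvg_geometric; rewrite ger0_norm.
have e20 : 0 < e / 2 by rewrite divr_gt0.
move=> /cvgr0_norm_lt/(_ _ e20)[S _ gS].
exists (S + T)%N => //= t St; have tE : t = ((t - T) + T)%N.
  by rewrite subnK // (leq_trans _ St) // leq_addl.
have St' : (S <= t - T)%N by rewrite -(leq_add2r T) -tE.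
have /(le_lt_trans (ler_norm _)) g := gS _ St'.
rewrite ger0_norm // tE (le_lt_trans (aT _)) //.
by move: g; rewrite /geometric /=; lra.
Qed.

Local Notation normc := ComplexField.Normc.normc.

Lemma normc_ge0 (R : rcfType) (z : R[i]) : 0 <= normc z.
Proof. by case: z => a b; exact: sqrtr_ge0. Qed.

Lemma normc_sqr (R : rcfType) (z : R[i]) :
  normc z ^+ 2 = complex.Re z ^+ 2 + complex.Im z ^+ 2.
Proof. by case: z => a b; rewrite sqr_sqrtr // addr_ge0 ?sqr_ge0. Qed.

Lemma normcX (R : rcfType) (z : R[i]) t : normc (z ^+ t) = normc z ^+ t.
Proof.
elim: t => [|t IH]; first by rewrite !expr0 ComplexField.Normc.normc1.
by rewrite !exprS ComplexField.Normc.normcM IH.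
Qed.

Lemma normc_real (R : rcfType) (x : R) : normc (real_complex R x) = `|x|.
Proof. by rewrite /= expr0n addr0 sqrtr_sqr. Qed.

(** Evaluating q * 'X^t at M gives a sequence in t on which multiplying q by
    'X - z acts as (shift - z). One root z of modulus less than 1 is removed at
    a time by [contraction_cvg0], entry by entry. *)
Lemma horner_pow_cvg0 (R : realType) (n : nat) (M : 'M[R[i]]_n.+1)
    (s : seq R[i]) (q : {poly R[i]}) :
  (forall z, z \in s -> normc z < 1) ->
  (forall i j, normc (horner_mx M (q * \prod_(z <- s) ('X - z%:P) * 'X^t) i j)
     @[t --> \oo] --> (0 : R)) ->
  forall i j, normc (horner_mx M (q * 'X^t) i j) @[t --> \oo] --> (0 : R).
Proof.
elim: s q => [|z s IH] q s1 qs i j.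
  by have := qs i j; rewrite big_nil mulr1.
have z1 : normc z < 1 by apply: s1; rewrite mem_head.
have {}IH := IH (q * ('X - z%:P)).
apply: (@contraction_cvg0 _ (normc z) _
  (fun t => normc (horner_mx M (q * ('X - z%:P) * 'X^t) i j))).
- by rewrite normc_ge0.
- by move=> t; exact: normc_ge0.
- move=> t; rewrite -ComplexField.Normc.normcM; apply: le_trans (le_normcD _ _).
  have -> : q * 'X^(t.+1) = z *: (q * 'X^t) + q * ('X - z%:P) * 'X^t.
    by rewrite exprS -mul_polyC; ring.
  by rewrite linearD linearZ /= !mxE.
- apply: IH => [w ws|]; first by apply: s1; rewrite in_cons ws orbT.
  by move=> k l; have := qs k l; rewrite big_cons mulrA.
Qed.

Lemma eigen_lt1_pow_cvg0 (R : realType) (n : nat) (M : 'M[R[i]]_n.+1) :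
  (forall z, eigenvalue M z -> normc z < 1) ->
  forall i j, normc ((M ^+ t) i j) @[t --> \oo] --> (0 : R).
Proof.
move=> eig1 i j.
have [s sE] := closed_field_poly_normal (char_poly M).
have lc1 : lead_coef (char_poly M) = 1 by apply/monicP; exact: char_poly_monic.
rewrite lc1 scale1r in sE.
suff : normc (horner_mx M (1 * 'X^t) i j) @[t --> \oo] --> (0 : R).
  by under eq_fun do rewrite mul1r rmorphXn /= horner_mx_X.
apply: (@horner_pow_cvg0 _ _ _ s) => [z zs|k l].
  by apply: eig1; rewrite eigenvalue_root_char sE root_prod_XsubC.
rewrite -sE mul1r.
under eq_fun do
  rewrite rmorphM /= Cayley_Hamilton mul0r mxE ComplexField.Normc.normc0.
exact: cvg_cst.
Qed.

(** The real and imaginary parts a and b of a left eigenvector v are real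
    vectors with |a M|^2 + |b M|^2 = |l|^2 (|a|^2 + |b|^2), so that
    submultiplicativity over the reals is enough. *)
Lemma eigenvalue_le_sqF (R : realType) (n : nat) (M : 'M[R]_n) (l : R[i]) :
  eigenvalue (map_mx (real_complex R) M) l -> normc l ^+ 2 <= sqF M.
Proof.
move=> /eigenvalueP[v vM v0].
pose a : 'rV[R]_n := map_mx (@complex.Re R) v.
pose b : 'rV[R]_n := map_mx (@complex.Im R) v.
have sq (w : 'rV[R[i]]_n) : sqF (map_mx (@complex.Re R) w) +
    sqF (map_mx (@complex.Im R) w) = \sum_j normc (w 0 j) ^+ 2.
  rewrite /sqF !big_ord1 -big_split; apply: eq_bigr => j _ /=.
  by rewrite !mxE normc_sqr.
have ReM : map_mx (@complex.Re R) (v *m map_mx (real_complex R) M) = a *m M.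
  apply/matrixP => i j; rewrite !mxE raddf_sum; apply: eq_bigr => k _.
  by rewrite !mxE; case: (v i k) => x y /=; rewrite mulr0 subr0.
have ImM : map_mx (@complex.Im R) (v *m map_mx (real_complex R) M) = b *m M.
  apply/matrixP => i j; rewrite !mxE raddf_sum; apply: eq_bigr => k _.
  by rewrite !mxE; case: (v i k) => x y /=; rewrite mulr0 add0r.
have ab0 : 0 < sqF a + sqF b.
  rewrite sq lt_neqAle eq_sym sumr_ge0 ?andbT; last by move=> *; exact: sqr_ge0.
  apply: contra v0; rewrite psumr_eq0; last by move=> *; exact: sqr_ge0.
  move=> /allP h; apply/eqP/rowP => j; rewrite mxE.
  have := h j (mem_index_enum _); rewrite /= sqrf_eq0 => /eqP.
  exact: ComplexField.Normc.eq0_normc.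
have := sq (v *m map_mx (real_complex R) M); rewrite ReM ImM vM.
under eq_bigr do rewrite mxE ComplexField.Normc.normcM exprMn.
rewrite -mulr_sumr -sq -/a -/b => h.
rewrite -(ler_pM2r ab0) -h mulrDr [_ * sqF a]mulrC [_ * sqF b]mulrC.
by rewrite lerD // sqF_mulmx.
Qed.

Lemma eigenvalueX (F : fieldType) (n : nat) (M : 'M[F]_n) (l : F) t :
  eigenvalue M l -> eigenvalue (M ^+ t) (l ^+ t).
Proof.
move=> /eigenvalueP[v vM v0]; apply/eigenvalueP; exists v => //.
elim: t => [|t IH]; first by rewrite expr0 mulmx1 scale1r.
by rewrite !exprSr [_ * M]/(_ *m M) mulmxA IH -scalemxAl vM scalerA.
Qed.

Lemma map_mx_exp (R S : pzRingType) (f : {rmorphism R -> S}) (n : nat)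
    (M : 'M[R]_n) t :
  map_mx f (M ^+ t) = map_mx f M ^+ t.
Proof.
elim: t => [|t IH]; first exact: map_mx1.
by rewrite !exprS -IH; exact: map_mxM.
Qed.

(** Bernoulli's inequality, in the form that bounds x away from 1 when x ^+ t
    is. *)
Lemma one_sub_exp_le (R : realFieldType) (x : R) t :
  0 <= x <= 1 -> 1 - x ^+ t <= t%:R * (1 - x).
Proof.
move=> /andP[x0 x1]; elim: t => [|t IH]; first by rewrite expr0 subrr mul0r.
have : x * (1 - x ^+ t) <= 1 - x ^+ t.
  by apply: ler_piMl; rewrite // subr_ge0 exprn_ile1.
rewrite exprS -natr1; lra.
Qed.

Lemma eigenvalue_le_spectral_radius (R : realType) (n : nat) (M : 'M[R]_n)
    (l : R[i]) :
  eigenvalue (map_mx (real_complex R) M) l -> normc l <= spectral_radius M.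
Proof.
move=> Ml; apply: sup_upper_bound; last by exists l.
split; first by exists (normc l), l.
(* Eigenvalues satisfy |z| <= 1 + |z| ^+ 2 <= 1 + sqF M. *)
exists (1 + sqF M) => _ [z /eigenvalue_le_sqF h <-].
by have := sqr_ge0 (normc z - 1); rewrite sqrrB1; have := normc_ge0 z; lra.
Qed.

Lemma sqF_pow_cvg0 (R : realType) (n : nat) (M : 'M[R]_n.+1) :
  spectral_radius M < 1 -> sqF (M ^+ t) @[t --> \oo] --> (0 : R).
Proof.
move=> rho1.
have h i j : normc ((map_mx (real_complex R) M ^+ t) i j)
    @[t --> \oo] --> (0 : R).
  apply: eigen_lt1_pow_cvg0 => z /eigenvalue_le_spectral_radius.
  by move/le_lt_trans; exact.
have cv i j : (M ^+ t) i j @[t --> \oo] --> (0 : R).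
  apply/norm_cvg0P; under eq_fun do rewrite -normc_real.
  by have := h i j; under eq_fun do rewrite -map_mx_exp mxE.
have -> : (0 : R) = sqF (0 : 'M[R]_n.+1).
  by rewrite /sqF big1 // => i _; rewrite big1 // => j _; rewrite mxE expr0n.
apply: cvg_sqF => i j; rewrite mxE; exact: cv.
Qed.

(** From right to left, every eigenvalue l satisfies
    |l| ^+ (2 t) <= sqF (M ^+ t) < 1; the supremum of the moduli is then less
    than 1 because Bernoulli's inequality gives a bound uniform in l. *)
Lemma spectral_radius_lt1P (R : realType) (n : nat) (M : 'M[R]_n.+1) :
  spectral_radius M < 1 <-> exists2 t, (0 < t)%N & sqF (M ^+ t) < 1.
Proof.
split=> [/sqF_pow_cvg0/cvgr0_norm_lt/(_ _ ltr01)[T _ hT]|[t t0 Mt1]].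
  exists T.+1 => //.
  by have := hT T.+1 (leqnSn T); apply: le_lt_trans; exact: ler_norm.
(* The exponent is t + t because sqF bounds the squared moduli:
   1 - |l| ^+ (t + t) <= (t + t) * (1 - |l|). *)
pose x := 1 - (1 - sqF (M ^+ t)) / (t + t)%:R.
have x1 : x < 1.
  by rewrite ltrBlDr ltrDl divr_gt0 ?subr_gt0 // ltr0n addn_gt0 t0.
have x0 : 0 <= x.
  rewrite subr_ge0 ler_pdivrMr ?ltr0n ?addn_gt0 ?t0 // mul1r.
  have := sqF_ge0 (M ^+ t); have : 1 <= (t + t)%:R :> R.
    by rewrite ler1n addn_gt0 t0.
  lra.
apply: le_lt_trans x1; rewrite /spectral_radius.
have [->|/set0P S0] := eqVneq [set normc l | l in
  [set l : R[i] | eigenvalue (map_mx (real_complex R) M) l]] set0.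
  by rewrite sup0.
apply: ge_sup => // _ [l /= Ml <-].
have l0 := normc_ge0 l.
have := eigenvalueX t Ml; rewrite -map_mx_exp.
move=> /eigenvalue_le_sqF; rewrite normcX -exprM muln2 -addnn => h.
have l1 : normc l <= 1.
  rewrite leNgt; apply/negP => l1; move: Mt1; rewrite ltNge => /negP; apply.
  by apply: le_trans h; rewrite exprn_ege1 // ltW.
have := one_sub_exp_le (t + t) (introT andP (conj l0 l1)).
rewrite lerBrDr -lerBrDl ler_pdivrMr ?ltr0n ?addn_gt0 ?t0 //.
by rewrite mulrC; lra.
Qed.

(** With c = sqF (M ^+ N) < 1, splitting off the first N terms gives
    s T <= s (N + T) <= s N + c * s T for the partial sums s, hence
    s T <= s N / (1 - c). *)
Lemma pow_sum_bounded (R : realType) (n : nat) (M : 'M[R]_n.+1) :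
  spectral_radius M < 1 -> exists b, forall T, \sum_(t < T) sqF (M ^+ t) <= b.
Proof.
move=> /spectral_radius_lt1P[N _ c1]; set c := sqF (M ^+ N) in c1.
pose s T := \sum_(t < T) sqF (M ^+ t).
exists (s N / (1 - c)) => T; rewrite -/(s T) ler_pdivlMr ?subr_gt0 //.
have sNT : s (N + T)%N <= s N + c * s T.
  rewrite /s big_split_ord /= lerD2l mulr_sumr; apply: ler_sum => t _.
  by rewrite exprD; exact: sqF_mulmx.
have sT : s T <= s (N + T)%N.
  rewrite addnC /s big_split_ord /= lerDl; apply: sumr_ge0 => t _.
  exact: sqF_ge0.
by lra.
Qed.

(** * Expectations of quadratic forms *)

(** In dimension 0 there is no eigenvalue and the infimum of the empty set is
    0. *)
Lemma min_singular_value_gt0_dim (R : realType) (n : nat) (M : 'M[R]_n) :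
  0 < min_singular_value M -> (0 < n)%N.
Proof.
case: n M => // M; rewrite /min_singular_value.
suff -> : [set Num.sqrt a | a in [set a | eigenvalue (M^T *m M) a]] = set0.
  by rewrite inf0 ltxx.
rewrite -subset0 => x [a /eigenvalueP[v _ v0] _]; case/negP: v0.
by apply/eqP; exact: thinmx0.
Qed.

Section second_moment.
Variables (R : realType) (n : nat) (D : probability (borel_cV R n) R).
Hypothesis hD : second_moments D.
Local Notation X0 := (second_moment_mx D).

Lemma integrable_quad (S : 'M[R]_n) :
  D.-integrable setT (fun x : borel_cV R n => (quad S x)%:E).
Proof.
under eq_fun do rewrite quadE -sumEFin; apply: integrable_sum => // i _.
under eq_fun do rewrite -sumEFin; apply: integrable_sum => // j _.
by under eq_fun do rewrite EFinM; apply: integrableZl => //; exact: hD.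
Qed.

Lemma integral_quad (S : 'M[R]_n) :
  (\int[D]_x (quad S x)%:E)%E = (\tr (S *m X0))%:E.
Proof.
have intS i j : D.-integrable setT
    (fun x : borel_cV R n => (S i j * ((x : 'cV_n) i 0 * (x : 'cV_n) j 0))%:E).
  by under eq_fun do rewrite EFinM; apply: integrableZl => //; exact: hD.
under eq_integral do rewrite quadE -sumEFin.
rewrite integral_sum //; last first.
  by move=> i; under eq_fun do rewrite -sumEFin; exact: integrable_sum.
rewrite /mxtrace -sumEFin; apply: eq_bigr => i _.
under eq_integral do rewrite -sumEFin.
rewrite integral_sum // mxE -sumEFin; apply: eq_bigr => j _.
under eq_integral do rewrite EFinM.
rewrite integralZl // EFinM; congr (_ * _)%E.
rewrite mxE unlock fineK; last exact/integrable_fin_num.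
by apply: eq_integral => x _; rewrite mulrC.
Qed.

Lemma trace_moment_le (S S' : 'M[R]_n) : (forall x, quad S x <= quad S' x) ->
  \tr (S *m X0) <= \tr (S' *m X0).
Proof.
move=> SS'; rewrite -lee_fin -!integral_quad; apply: le_integral => //.
- exact: integrable_quad.
- exact: integrable_quad.
- by move=> x _; rewrite lee_fin.
Qed.

Lemma second_moment_sym : X0^T = X0.
Proof.
apply/matrixP => i j; rewrite !mxE; congr (fine (expectation _ _)).
by apply/funext => x; rewrite mulrC.
Qed.

(** v^T X0 v is the expectation of the square (v^T x) ^+ 2, the quadratic form
    of the rank one matrix v v^T. *)
Lemma second_moment_psd v : 0 <= quad X0 v.
Proof.
have := @trace_moment_le 0 (v *m v^T); rewrite mul0mx mxtrace0.
rewrite mxtrace_mulC mulmxA mxtrace_mulC mulmxA trace_mx11; apply=> x.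
by apply: le_trans (quad_outer_ge0 v x); rewrite /quad mulmx0 mul0mx mxE.
Qed.

(** A singular X0 has 0 as an eigenvalue of X0^T X0, hence as a singular
    value. *)
Lemma second_moment_unit : 0 < min_singular_value X0 -> X0 \in unitmx.
Proof.
apply: contraTT => nu; rewrite -leNgt.
rewrite /min_singular_value -(sqrtr0 R); apply: ge_inf.
  by exists 0 => _ [a _ <-]; exact: sqrtr_ge0.
exists 0 => //=; have /rowV0Pn[v /sub_kermxP vX v0] : kermx X0 != 0.
  by rewrite kermx_eq0 row_free_unit.
apply/eigenvalueP; exists v => //.
by rewrite second_moment_sym mulmxA vX mul0mx scale0r.
Qed.

(** This is the expectation of |G x|^2; row by row, the coercivity of X0
    turns it into a multiple of sqF G. *)
Lemma trace_gram_moment (m : nat) (G : 'M[R]_(m, n)) :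
  \tr (G^T *m G *m X0) = \sum_i quad X0 (row i G)^T.
Proof.
rewrite -mulmxA mxtrace_mulC; apply: eq_bigr => i _.
rewrite /quad trmxK -row_mul mxE [RHS]mxE; apply: eq_bigr => j _.
by rewrite !mxE.
Qed.

Lemma trace_gram_moment_le (m : nat) (G : 'M[R]_(m, n)) :
  \tr (G^T *m G *m X0) <= (1 + sqF X0) * sqF G.
Proof.
rewrite trace_gram_moment (sqF_rows G) mulr_sumr; apply: ler_sum => i _.
exact: quad_le.
Qed.

Lemma trace_gram_moment_ge : 0 < min_singular_value X0 ->
  exists2 c : R, 0 < c &
    forall m (G : 'M[R]_(m, n)), c * sqF G <= \tr (G^T *m G *m X0).
Proof.
move=> /second_moment_unit.
case/(psd_unit_lower second_moment_sym second_moment_psd) => c c0 hc.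
exists c => // m G; rewrite trace_gram_moment (sqF_rows G) mulr_sumr.
by apply: ler_sum => i _; exact: hc.
Qed.

End second_moment.

(** The bound b keeps the series finite, so that fine returns its sum and not
    the default value 0. *)
Lemma partial_sum_le_fine (R : realType) (a : nat -> R) (b : R) :
  (forall t, 0 <= a t) -> (forall T, \sum_(t < T) a t <= b) ->
  forall T, \sum_(t < T) a t <= fine (\sum_(0 <= t <oo) (a t)%:E)%E.
Proof.
move=> a0 ab T; have a0' t : (0 <= t)%N -> true -> (0 <= (a t)%:E)%E.
  by move=> _ _; rewrite lee_fin.
have part k : (\sum_(0 <= t < k) (a t)%:E = (\sum_(t < k) a t)%:E)%E.
  by rewrite big_mkord sumEFin.
have le_ser k : ((\sum_(t < k) a t)%:E <= \sum_(0 <= t <oo) (a t)%:E)%E.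
  by rewrite -part; exact: nneseries_lim_ge.
have ser_le : (\sum_(0 <= t <oo) (a t)%:E <= b%:E)%E.
  apply: lime_le; first exact: is_cvg_nneseries.
  by apply: nearW => k; rewrite part lee_fin.
have fin : (\sum_(0 <= t <oo) (a t)%:E)%E \is a fin_num.
  rewrite ge0_fin_numE; first exact: le_lt_trans ser_le (ltry _).
  by have := le_ser 0; rewrite big_ord0.
by rewrite -lee_fin fineK.
Qed.

(** * The cost along the closed loop *)

Section closed_loop_cost.
Variables (R : realType) (n m d : nat).
Variables (A : 'M[R]_n.+1) (B : 'M[R]_(n.+1, m)) (C : 'M[R]_(d, n.+1)).
Variables (Q : 'M[R]_n.+1) (Ru : 'M[R]_m) (D : probability (borel_cV R n.+1) R).
Hypotheses (hQ : sym_posdef Q) (hRu : sym_posdef Ru).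
Hypothesis hD : second_moments D.
Local Notation X0 := (second_moment_mx D).
Local Notation M := (closed_loop A B C).

Lemma stateE K x t : state A B C K x t = M K ^+ t *m x.
Proof.
elim: t => [|t IH]; first by rewrite expr0 mul1mx.
rewrite /= IH exprS -[_ * _]/(_ *m _) /closed_loop !mulmxBl mulmxN.
by rewrite !mulmxA.
Qed.

Definition stage_mx (K : 'M[R]_(m, d)) := Q + C^T *m K^T *m Ru *m K *m C.

Lemma quad_stage_mx K x :
  quad (stage_mx K) x = quad Q x + quad Ru (K *m C *m x).
Proof. by rewrite quadD -quad_congr trmx_mul !mulmxA. Qed.

Lemma quad_stage_mx_ge0 K x : 0 <= quad (stage_mx K) x.
Proof. by rewrite quad_stage_mx addr_ge0 // posdef_psd. Qed.

Definition step_cost (K : 'M[R]_(m, d)) t : R :=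
  \tr ((M K ^+ t)^T *m stage_mx K *m M K ^+ t *m X0).

Lemma step_cost_ge0 K t : 0 <= step_cost K t.
Proof.
have := @trace_moment_le _ _ _ hD 0 ((M K ^+ t)^T *m stage_mx K *m M K ^+ t).
rewrite mul0mx mxtrace0; apply => x; rewrite quad_congr.
by rewrite {1}/quad mulmx0 mul0mx mxE quad_stage_mx_ge0.
Qed.

Lemma costE K : cost A B C Q Ru D K =
  fine (\sum_(0 <= t <oo) (step_cost K t)%:E)%E.
Proof.
rewrite /cost; congr fine.
have stE t (x : borel_cV R n.+1) :
    stage_cost Q Ru C K (state A B C K (x : 'cV[R]_n.+1) t) =
    quad ((M K ^+ t)^T *m stage_mx K *m M K ^+ t) x.
  by rewrite stateE quad_congr.
rewrite integral_nneseries //.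
- apply: eq_eseriesr => t _; rewrite -integral_quad //.
  by apply: eq_integral => x _; rewrite stE.
- move=> t; under eq_fun do rewrite stE.
  by have /integrableP[] := integrable_quad hD
    ((M K ^+ t)^T *m stage_mx K *m M K ^+ t).
- by move=> t x _; rewrite lee_fin stE quad_congr quad_stage_mx_ge0.
Qed.

(** The constant depends on K, which is harmless: the bound only serves to
    prove the cost of a feasible gain finite. *)
Lemma step_cost_le K t : step_cost K t <=
  (1 + sqF (stage_mx K)) * (1 + sqF X0) * sqF (M K ^+ t).
Proof.
set L := 1 + sqF (stage_mx K).
have L0 : 0 <= L by rewrite addr_ge0 ?sqF_ge0.
apply: (@le_trans _ _ (\tr (L *: ((M K ^+ t)^T *m M K ^+ t) *m X0))).
  apply: trace_moment_le => // x.
  by rewrite quad_congr quadZ quad_gram; exact: quad_le.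
rewrite -scalemxAl mxtraceZ -mulrA ler_wpM2l //.
exact: trace_gram_moment_le.
Qed.

Lemma partial_cost_le K : feasible A B C K ->
  forall T, \sum_(t < T) step_cost K t <= cost A B C Q Ru D K.
Proof.
move=> /pow_sum_bounded[b hb]; rewrite costE.
set L := (1 + sqF (stage_mx K)) * (1 + sqF X0).
apply: (@partial_sum_le_fine _ _ (L * b)) => [t|T]; first exact: step_cost_ge0.
have L0 : 0 <= L by rewrite mulr_ge0 // addr_ge0 ?sqF_ge0.
apply: le_trans (ler_wpM2l L0 (hb T)); rewrite mulr_sumr.
by apply: ler_sum => t _; exact: step_cost_le.
Qed.

(** Only the state term of the stage cost is kept, which makes the constant
    uniform in K. *)
Lemma step_cost_ge : 0 < min_singular_value X0 ->
  exists2 c : R, 0 < c & forall K t, c * sqF (M K ^+ t) <= step_cost K t.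
Proof.
case/(trace_gram_moment_ge hD) => x0 x00 hx0; have [q q0 hq] := posdef_lower hQ.
exists (q * x0) => [|K t]; first exact: mulr_gt0.
rewrite -mulrA; apply: (le_trans (ler_wpM2l (ltW q0) (hx0 _ _))).
rewrite -mxtraceZ scalemxAl; apply: trace_moment_le => // x.
rewrite quad_congr quadZ quad_gram (le_trans (hq _)) // quad_stage_mx.
by rewrite lerDl posdef_psd.
Qed.

(** Only the control term of the stage cost is kept: it dominates |K C x|^2,
    whose expectation dominates sqF (K C), and K is recovered from K C by a
    right inverse of C. *)
Lemma step_cost0_ge : row_free C -> 0 < min_singular_value X0 ->
  exists2 c : R, 0 < c & forall K, c * sqF K <= step_cost K 0.
Proof.
move=> hC; case/(trace_gram_moment_ge hD) => x0 x00 hx0.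
have [r r0 hr] := posdef_lower hRu.
have p0 : 0 < 1 + sqF (pinvmx C) by rewrite ltr_pwDl ?sqF_ge0.
exists (r * x0 / (1 + sqF (pinvmx C))) => [|K].
  by rewrite divr_gt0 ?mulr_gt0.
have KC : sqF K <= (1 + sqF (pinvmx C)) * sqF (K *m C).
  rewrite -{1}[K]mulmx1 -(mulmxVp hC) mulmxA (le_trans (sqF_mulmx _ _)) //.
  by rewrite mulrC ler_wpM2r ?sqF_ge0 // lerDr.
rewrite mulrAC ler_pdivrMr // mulrC.
apply: (@le_trans _ _ (r * x0 * ((1 + sqF (pinvmx C)) * sqF (K *m C)))).
  by rewrite mulrC ler_wpM2l // mulr_ge0 // ltW.
rewrite [leLHS]mulrCA [leRHS]mulrC ler_wpM2l ?(ltW p0) // -mulrA.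
apply: (le_trans (ler_wpM2l (ltW r0) (hx0 _ _))).
rewrite -mxtraceZ scalemxAl; apply: trace_moment_le => // x.
rewrite quad_congr quadZ quad_gram expr0 mul1mx (le_trans (hr _)) //.
by rewrite quad_stage_mx lerDr posdef_psd.
Qed.

Lemma step_cost_cvg (T : Type) (F : set_system T) {FF : Filter F}
    (K_ : T -> 'M[R]_(m, d)) K t :
  entry_cvg F K_ K -> step_cost (K_ x) t @[x --> F] --> step_cost K t.
Proof.
move=> KK; apply: entry_cvg_trace.
have MM : entry_cvg F (fun x => M (K_ x) ^+ t) (M K ^+ t).
  by apply: entry_cvg_exp; exact: entry_cvg_closed_loop.
apply: entry_cvg_mul; last exact: entry_cvg_cst.
apply: entry_cvg_mul => //; apply: entry_cvg_mul; first exact: entry_cvg_tr.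
apply: entry_cvg_add; first exact: entry_cvg_cst.
apply: entry_cvg_mul; last exact: entry_cvg_cst.
apply: entry_cvg_mul => //; apply: entry_cvg_mul; last exact: entry_cvg_cst.
apply: entry_cvg_mul; [exact: entry_cvg_cst|exact: entry_cvg_tr].
Qed.

(** A single power witnesses feasibility, and its Frobenius norm is continuous
    in the gain. *)
Lemma feasible_nbhs K : feasible A B C K -> nbhs K (feasible A B C).
Proof.
move=> /spectral_radius_lt1P[t t0 Kt].
have idK : entry_cvg (nbhs K) id K by apply: cvg_entry_cvg; exact: cvg_id.
have : sqF (M K' ^+ t) @[K' --> K] --> sqF (M K ^+ t).
  apply: (@cvg_sqF _ _ _ (nbhs_filter K)).
  by apply: entry_cvg_exp; exact: entry_cvg_closed_loop.
move=> /cvgr_lt/(_ _ Kt); apply: filterS => K' K't.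
by apply/spectral_radius_lt1P; exists t.
Qed.

Lemma boundary_infeasible K : boundary (feasible A B C) K -> ~ feasible A B C K.
Proof. by case=> _ cK /feasible_nbhs/cK[K' []]. Qed.

(** Infeasibility gives sqF (M K ^+ t) >= 1 for every t > 0, so each step cost
    after the first is at least the constant of [step_cost_ge]. *)
Lemma partial_cost_unbounded K : 0 < min_singular_value X0 ->
  ~ feasible A B C K -> forall a, exists T, a < \sum_(t < T) step_cost K t.
Proof.
move=> hmu nK a; have [c c0 hc] := step_cost_ge hmu.
(* The extra term is the one at time 0, where the criterion says nothing. *)
exists (Num.bound (`|a| / c)).+1.
have := archi_boundP (divr_ge0 (normr_ge0 a) (ltW c0)).
rewrite ltr_pdivrMr // => /(le_lt_trans (ler_norm a))/lt_le_trans; apply.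
rewrite big_ord_recl ler_wpDl ?step_cost_ge0 //.
rewrite -[X in X%:R]card_ord -sum1_card natr_sum mulr_suml.
apply: ler_sum => t _; rewrite mul1r; apply: le_trans (hc _ _).
rewrite ler_peMr ?(ltW c0) // leNgt; apply/negP => h; apply: nK.
by apply/spectral_radius_lt1P; exists (lift ord0 t).
Qed.

End closed_loop_cost.

Theorem lemma3 (R : realType) (n m d : nat)
    (A : 'M[R]_n) (B : 'M[R]_(n, m)) (C : 'M[R]_(d, n))
    (Q : 'M[R]_n) (Ru : 'M[R]_m)
    (D : probability (borel_cV R n) R)
    (hC : row_free C)
    (hQ : sym_posdef Q) (hRu : sym_posdef Ru)
    (hD : second_moments D)
    (hne : feasible A B C !=set0)
    (hmu : 0 < min_singular_value (second_moment_mx D))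
    (K_ : nat -> 'M[R]_(m, d))
    (hK : forall i, feasible A B C (K_ i)) :
    (spectral_norm (K_ i) @[i --> \oo] --> +oo) \/
    (exists2 K : 'M[R]_(m, d),
       boundary (feasible A B C) K & K_ i @[i --> \oo] --> K) ->
    cost A B C Q Ru D (K_ i) @[i --> \oo] --> +oo.
Proof.
have n0 := min_singular_value_gt0_dim hmu.
case: n A B C Q D hC hQ hD hne hmu hK n0 => // n A B C Q D hC hQ hD _ hmu hK _.
move=> [Koo|[K /boundary_infeasible nK KK]]; apply/cvgryPge => a.
  have [c c0 hc] := step_cost0_ge A B hQ hRu hD hC hmu.
  move/cvgryPge: Koo => /(_ (Num.max 1 (a / c))); apply: filterS => i.
  rewrite ge_max => /andP[s1 sa].
  apply: le_trans (partial_cost_le hQ hRu hD (hK i) 1); rewrite big_ord1.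
  apply: le_trans (hc _); rewrite mulrC -ler_pdivrMr // (le_trans sa) //.
  have sK := spectral_norm_le (K_ i); apply: (le_trans sK).
  (* As the spectral norm is at least 1, so is the square root of sqF, which
     is then at most sqF. *)
  rewrite -[leRHS]sqr_sqrtr ?sqF_ge0 // expr2.
  by rewrite ler_peMr ?sqrtr_ge0 // (le_trans s1).
have [T aT] := partial_cost_unbounded hQ hRu hD hmu nK a.
have : \sum_(t < T) step_cost A B C Q Ru D (K_ i) t @[i --> \oo] -->
    \sum_(t < T) step_cost A B C Q Ru D K t.
  by apply: cvgr_sum => t; apply: step_cost_cvg; exact: cvg_entry_cvg.
move=> /cvgr_gt/(_ _ aT); apply: filterS => i /ltW ai.
exact: le_trans ai (partial_cost_le hQ hRu hD (hK i) T).
Qed.
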